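(* Let $(A,\mu,\alpha)$ be a finite-dimensional simple Hom-alternative algebra. Then $(A,\mu,\alpha)$ is of alternative type, and $\alpha$ is an automorphism of both $(A,\mu,\alpha)$ and its induced alternative algebra $(A,\mu'=\alpha^{-1}\circ\mu)$.
   Context: All vector spaces are over a fixed field $\mathbb{K}$ of characteristic $0$. A Hom-algebra is a triple $(A,\mu,\alpha)$ with $A$ a vector space, $\mu:A\otimes A\to A$ linear and $\alpha:A\to A$ linear; it is multiplicative if $\alpha\circ\mu=\mu\circ(\alpha\otimes\alpha)$. Its Hom-associator is $as_A(x,y,z)=\mu(\mu(x,y),\alpha(z))-\mu(\alpha(x),\mu(y,z))$. A Hom-alternative algebra is a multiplicative Hom-algebra with $as_A(x,x,y)=0$ and $as_A(x,y,y)=0$ for all $x,y\in A$. A two-sided Hom-ideal is a linear subspace $H\subseteq A$ such that $\alpha(H)\subseteq H$ and $\mu(a,b),\mu(b,a)\in H$ for all $a\in A$, $b\in H$. A Hom-alternative algebra $(A,\mu,\alpha)$ with $\alpha\neq 0$ is simple if $\mu(A,A)\neq\{0\}$ and it has no proper two-sided Hom-ideal (i.e. none other than $\{0\}$ and $A$). A morphism $f:(A,\mu_A,\alpha_A)\to(B,\mu_B,\alpha_B)$ of Hom-algebras is a linear map with $f\circ\alpha_A=\alpha_B\circ f$ and $f\circ\mu_A=\mu_B\circ(f\otimes f)$; an automorphism is a bijective endomorphism. $(A,\mu,\alpha)$ is of alternative type if there is an alternative algebra $(A,\mu')$ with $\mu=\alpha\circ\mu'$; $(A,\mu')$ is then called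 the induced (or compatible) alternative algebra; when $\alpha$ is invertible, $\mu'=\alpha^{-1}\circ\mu$. *)

(* Defs.v *)
From HB Require Import structures.
From mathcomp Require Import all_boot all_order all_algebra.

Set Implicit Arguments.
Unset Strict Implicit.
Unset Printing Implicit Defensive.

Import GRing.Theory.
Local Open Scope ring_scope.

(* A Hom-algebra (A, mu, alpha) is given by A : vectType K (so that A is
   finite-dimensional), mu : {bilinear A -> A -> A} (i.e., a linear map
   A (x) A -> A) and alpha : 'End(A). *)

Section HomAlgebra.
Variables (K : fieldType) (A : vectType K).
Implicit Types (mu : {bilinear A -> A -> A}) (alpha : 'End(A)).

Definition multiplicative mu alpha : Prop :=
  forall x y, alpha (mu x y) = mu (alpha x) (alpha y).

Definition hom_associator mu alpha (x y z : A) : A :=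
  mu (mu x y) (alpha z) - mu (alpha x) (mu y z).

Definition hom_alternative mu alpha : Prop :=
  [/\ multiplicative mu alpha,
      forall x y, hom_associator mu alpha x x y = 0
    & forall x y, hom_associator mu alpha x y y = 0].

Definition hom_ideal mu alpha (H : {vspace A}) : Prop :=
  (forall b, b \in H -> alpha b \in H) /\
  (forall a b, b \in H -> mu a b \in H /\ mu b a \in H).

Definition simple_hom_alternative mu alpha : Prop :=
  [/\ hom_alternative mu alpha, alpha <> 0, exists x y, mu x y <> 0
    & forall H : {vspace A}, hom_ideal mu alpha H -> H = 0%VS \/ H = fullv].

Definition associator mu (x y z : A) : A := mu (mu x y) z - mu x (mu y z).

Definition alternative mu : Prop :=
  (forall x y, associator mu x x y = 0) /\
  (forall x y, associator mu x y y = 0).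

Definition induced_alternative mu alpha (mu' : {bilinear A -> A -> A}) : Prop :=
  alternative mu' /\ forall x y, mu x y = alpha (mu' x y).

Definition alternative_type mu alpha : Prop :=
  exists mu' : {bilinear A -> A -> A}, induced_alternative mu alpha mu'.

Definition twisted_mul (f : 'End(A)) mu (x y : A) : A := f (mu x y).

Fact twisted_mul_is_bilinear f mu :
  bilinear_for (GRing.Scale.Law.clone K A *:%R _)
    (GRing.Scale.Law.clone K A *:%R _) (twisted_mul f mu).
Proof.
by split=> u a x y; rewrite /twisted_mul ?linearPl ?linearPr linearP.
Qed.

HB.instance Definition _ f mu :=
  bilinear_isBilinear.Build K A A A *:%R *:%R (twisted_mul f mu)
    (twisted_mul_is_bilinear f mu).

End HomAlgebra.

Section Morphism.
Variables (K : fieldType) (A B : vectType K).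

Definition algebra_morphism (muA : {bilinear A -> A -> A})
    (muB : {bilinear B -> B -> B}) (f : 'Hom(A, B)) : Prop :=
  forall x y, f (muA x y) = muB (f x) (f y).

Definition hom_algebra_morphism (muA : {bilinear A -> A -> A})
    (alphaA : 'End(A)) (muB : {bilinear B -> B -> B}) (alphaB : 'End(B))
    (f : 'Hom(A, B)) : Prop :=
  (forall x, f (alphaA x) = alphaB (f x)) /\ algebra_morphism muA muB f.

End Morphism.

Section Automorphism.
Variables (K : fieldType) (A : vectType K).

Definition algebra_automorphism (mu : {bilinear A -> A -> A})
    (f : 'End(A)) : Prop :=
  algebra_morphism mu mu f /\ bijective f.

Definition hom_algebra_automorphism (mu : {bilinear A -> A -> A})
    (alpha f : 'End(A)) : Prop :=
  hom_algebra_morphism mu alpha mu alpha f /\ bijective f.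

End Automorphism.

(* Main.v *)
Require Import Defs.
From mathcomp Require Import all_boot all_order all_algebra.

(** The kernel of a multiplicative [alpha] is a two-sided Hom-ideal: it is
    [alpha]-stable, and multiplicativity carries [alpha (mu a b)] to a product
    with a zero factor ([lker_hom_ideal]).  Simplicity and [alpha <> 0] force
    that kernel to be [0], so, in finite dimension, [alpha] is bijective.

    An invertible multiplicative [alpha] can be untwisted.  Put
    [mu' = alpha^-1 \o mu].  Since [alpha^-1] is multiplicative as well, the two
    powers of [alpha^-1] in a double [mu']-product can be pulled out in front,
    which leaves [alpha] on the argument that is multiplied last:
    [associator mu' = alpha^-2 \o hom_associator mu alpha]
    ([associator_untwist]).  So the Hom-alternative identities of [mu] become
    the alternative identities of [mu']. *)

Set Implicit Arguments.
Unset Strict Implicit.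
Unset Printing Implicit Defensive.

Import GRing.Theory.
Local Open Scope ring_scope.

Lemma lker_hom_ideal (K : fieldType) (A : vectType K)
    (mu : {bilinear A -> A -> A}) (alpha : 'End(A)) :
  Defs.multiplicative mu alpha -> hom_ideal mu alpha (lker alpha).
Proof.
move=> alphaM; split=> [b | a b]; rewrite !memv_ker => /eqP alphab0.
  by rewrite alphab0 linear0.
by rewrite !alphaM alphab0 linear0l linear0r eqxx.
Qed.

Lemma simple_lker0 (K : fieldType) (A : vectType K)
    (mu : {bilinear A -> A -> A}) (alpha : 'End(A)) :
  simple_hom_alternative mu alpha -> lker alpha == 0%VS.
Proof.
case=> -[alphaM _ _] alpha_neq0 _ simpleA.
case: (simpleA _ (lker_hom_ideal alphaM)) => [-> // | kerT].
case: alpha_neq0; apply/lfunP=> x; apply/eqP.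
by rewrite zero_lfunE -memv_ker kerT memvf.
Qed.

Section Untwist.

Variables (K : fieldType) (A : vectType K).
Variables (mu : {bilinear A -> A -> A}) (alpha : 'End(A)).
Hypothesis alphaM : Defs.multiplicative mu alpha.
Hypothesis alpha_inj : lker alpha == 0%VS.

Let alphaK : cancel alpha (alpha^-1)%VF := lker0_lfunK alpha_inj.
Let alphaVK : cancel (alpha^-1)%VF alpha := lker0_lfunVK alpha_inj.

Lemma multiplicative_inv : Defs.multiplicative mu (alpha^-1)%VF.
Proof. by move=> x y; apply: (can_inj alphaK); rewrite alphaM !alphaVK. Qed.

(** [alpha^-1 (mu (alpha^-1 (mu x y)) z)] is [alpha^-2 (mu (mu x y) (alpha z))],
    as [z] is [alpha^-1 (alpha z)] and [alpha^-1] is multiplicative; the term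
    bracketed to the right is symmetric. *)
Lemma associator_untwist (x y z : A) :
  associator (twisted_mul (alpha^-1)%VF mu) x y z =
  (alpha^-1)%VF ((alpha^-1)%VF (hom_associator mu alpha x y z)).
Proof.
rewrite /associator /hom_associator /= /twisted_mul !linearB /=.
by rewrite !(multiplicative_inv (mu _ _)) !(multiplicative_inv (alpha _)) !alphaK.
Qed.

Lemma morphism_untwist :
  algebra_morphism (twisted_mul (alpha^-1)%VF mu)
    (twisted_mul (alpha^-1)%VF mu) alpha.
Proof. by move=> x y; rewrite /= /twisted_mul -alphaM alphaK alphaVK. Qed.

Lemma induced_alternative_untwist :
  hom_alternative mu alpha ->
  induced_alternative mu alpha (twisted_mul (alpha^-1)%VF mu).
Proof.
case=> _ altl altr; split; last by move=> x y; rewrite /= /twisted_mul alphaVK.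
by split=> x y; rewrite associator_untwist ?altl ?altr !linear0.
Qed.

End Untwist.

(* alpha^-1%VF, a total operation on 'End(A), is the two-sided inverse of alpha
   here, since the second conjunct makes alpha bijective. *)
Theorem proposition3p9 (K : fieldType) (char0 : [pchar K] =i pred0)
    (A : vectType K) (mu : {bilinear A -> A -> A}) (alpha : 'End(A))
    (simpleA : simple_hom_alternative mu alpha) :
  [/\ alternative_type mu alpha,
      hom_algebra_automorphism mu alpha alpha,
      induced_alternative mu alpha (twisted_mul (alpha^-1)%VF mu)
    & algebra_automorphism (twisted_mul (alpha^-1)%VF mu) alpha].
Proof.
have alpha_inj := simple_lker0 simpleA.
have [altA _ _ _] := simpleA; have [alphaM _ _] := altA.
have alpha_bij : bijective alpha.
  exact: Bijective (lker0_lfunK alpha_inj) (lker0_lfunVK alpha_inj).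
have ind := induced_alternative_untwist alphaM alpha_inj altA.
split=> //; first by exists (twisted_mul (alpha^-1)%VF mu).
by split=> //; apply: morphism_untwist.
Qed.
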